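(* Let $g\in\mathbb{N}_0$ and let $r$ be an integer with $\frac{g+2}{3}\leq r\leq \lfloor\frac{g}{2}\rfloor$. Define $\omega=\lfloor\frac{g}{2}\rfloor-r$. 1. If $\Omega$ is a numerical semigroup of genus $\omega$ and $B$ is an $\Omega$-closed set of size $\omega+1$ with first (smallest) element equal to $0$, then $$\{2j:j \in\Omega\}\cup \{2j-2\max(B)+2g+1:j\in B\}\cup(2g+\mathbb{N}_0)$$ is a numerical semigroup of genus $g$ and ordinarization number $r$. 2. Every numerical semigroup of genus $g$ and ordinarization number $r$ can be uniquely written as $$\{2j:j \in\Omega\}\cup \{2j-2\max(B)+2g+1:j\in B\}\cup(2g+\mathbb{N}_0)$$ for a unique numerical semigroup $\Omega$ of genus $\omega$ and a unique $\Omega$-closed set $B$ of size $\omega+1$ with first element equal to $0$. 3. The number of numerical semigroups of genus $g$ and ordinarization number $r$ depends only on $\omega$. It is exactly $$\sum_{\Omega \text{ numerical semigroup of genus }\omega}\#C(\Omega,\omega+1).$$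
   Context: $\mathbb{N}_0$ is the set of non-negative integers. A numerical semigroup is a subset of $\mathbb{N}_0$ that is closed under addition, contains $0$, and has finite complement in $\mathbb{N}_0$. The elements of the complement are called gaps, the number of gaps is the genus, the largest gap is the Frobenius number, and the smallest non-zero element of the semigroup is its multiplicity. A numerical semigroup of genus $g$ is ordinary if its gaps are all in a row, i.e. it equals $\{0,g+1,g+2,\dots\}$; $\mathbb{N}_0$ (genus $0$) counts as ordinary. The ordinarization transform $\Lambda'$ of a non-ordinary numerical semigroup $\Lambda$ with Frobenius number $F$ and multiplicity $m$ is $(\Lambda\setminus\{m\})\cup\{F\}$, which is a numerical semigroup of the same genus; the ordinarization transform of an ordinary semigroup is itself. Put $\Lambda^{(0)}=\Lambda$ and $\Lambda^{(i)}=(\Lambda^{(i-1)})'$. The ordinarization number of $\Lambda$ is the smallest $i\geq 0$ such that $\Lambda^{(i)}$ is ordinary (such $i$ exists). For a numerical semigroup $\Lambda$, a finite non-empty set $B\subset\mathbb{N}_0$ is called $\Lambda$-closed if for every $b\in B$ and every $\lambda\in\Lambda$, the sum $b+\lambda$ is either in $B$ or larger than $\max(B)$. $C(\Lambda,i)$ denotes the collection of $\Lambda$-closed sets of size $i$ that contain $0$. *)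

(* Defs.v *)
From mathcomp Require Export all_boot all_order all_algebra.
From mathcomp Require Export finmap.
From mathcomp Require Export all_classical.

Set Implicit Arguments.
Unset Strict Implicit.
Unset Printing Implicit Defensive.

Local Open Scope classical_set_scope.
Local Open Scope nat_scope.

Definition numerical_semigroup (L : set nat) : Prop :=
  [/\ L 0, forall a b, L a -> L b -> L (a + b) & finite_set (~` L)].

(* [fset_set A] lists a finite set [A], and is [fset0] if [A] is infinite;
   [gaps] and [card] are only meaningful for cofinite, resp. finite, sets. *)
Definition gaps (L : set nat) : {fset nat} := fset_set (~` L).

Definition card (T : choiceType) (A : set T) : nat := #|` fset_set A|.

Definition genus (L : set nat) : nat := #|` gaps L|.

(* The Frobenius number; 0, a value never used below, if there are no gaps. *)
Definition frobenius (L : set nat) : nat := \max_(n <- gaps L) n.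

(* The least element of [P], or 0 if [P] is empty. *)
Definition least (P : set nat) : nat :=
  xget 0 [set n | P n /\ forall k, P k -> n <= k].

Definition multiplicity (L : set nat) : nat := least [set n | L n /\ n != 0].

Definition ordinary (L : set nat) : Prop :=
  L = [set n | n = 0 \/ genus L < n].

Definition ordinarization (L : set nat) : set nat :=
  if `[< ordinary L >] then L
  else (L `\ multiplicity L) `|` [set frobenius L].

Definition ordinarization_number (L : set nat) : nat :=
  least [set i | ordinary (iter i ordinarization L)].

Definition semigroups_of_genus (g : nat) : set (set nat) :=
  [set L | numerical_semigroup L /\ genus L = g].

Definition semigroups_of_genus_ordnumber (g r : nat) : set (set nat) :=
  [set L | [/\ numerical_semigroup L, genus L = g
             & ordinarization_number L = r]].

Definition fmax (B : {fset nat}) : nat := \max_(b <- B) b.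

Definition closed_set (L : set nat) (B : {fset nat}) : Prop :=
  B != fset0 /\
  forall b l, b \in B -> L l -> b + l \in B \/ fmax B < b + l.

Definition closed_sets (L : set nat) (i : nat) : set {fset nat} :=
  [set B | [/\ closed_set L B, #|` B| = i & 0 \in B]].

(* The elements coming from [B] are computed in [int], so the subtraction is
   not truncated. Keeping only the naturals loses nothing when [Omega] has
   genus [w] with [2 * w <= g] and [B] is an [Omega]-closed set of size [w.+1]
   containing 0: all of [Omega] up to [fmax B] lies in [B], so
   [fmax B <= 2 * w <= g]. *)
Definition semigroup_from (g : nat) (Omega : set nat) (B : {fset nat}) :
    set nat :=
  [set (2 * j)%N | j in Omega]
  `|` [set n : nat | exists2 j : nat, j \in B &
        (n%:Z = 2 * j%:Z - 2 * (fmax B)%:Z + 2 * g%:Z + 1)%R]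
  `|` [set n | 2 * g <= n].

(* Main.v *)
Require Import Defs.
From mathcomp Require Import zify.

Set Implicit Arguments.
Unset Strict Implicit.
Unset Printing Implicit Defensive.

Local Open Scope classical_set_scope.
Local Open Scope nat_scope.

(** The ordinarization number of a numerical semigroup [L] of genus [g] is the
    number of its nonzero elements that are at most [g]: each transform trades
    one of these, the multiplicity, for a Frobenius number above [g], and [L]
    is ordinary exactly when none is left ([ordinarization_numberE]).

    Suppose that there are [r] such elements, with [3 * r >= g + 2].  The heart
    of the matter is that all of them are even ([semigroup_even]).  Let [a] be
    the largest one.  The sums of two elements of [L] in [0, a] lie in
    [L] and in [0, 2 * g], where [L] has just [g + 1] elements because all gaps
    are below [2 * g].  If the elements up to [a] had no common divisor, there
    would be at least [3 * r] such sums by a theorem of the type of Freiman's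
    3k-3 theorem ([freiman_sparse]), a contradiction.  So they are
    multiples of some [d >= 2]; then [d * r <= g] forces [d = 2].

    Freiman's theorem is only needed for a set in which every element [x] has
    at most [x / 2] nonzero elements of the set up to it, which holds for [L]
    up to its genus ([semigroup_sparse]).  This allows a short elementary
    induction on the largest element [a]: cut the set at the largest [b < a]
    for which the part above [b] has density at most one half.  Between [b] and
    [a] the set is then dense seen from [a], so that by the pigeonhole
    principle an interval ending at [2 * a] consists of sums
    ([dense_top]); the induction hypothesis counts the sums below the cut, and
    one further sum across the cut makes up the bound.

    Once the elements of [L] up to [g] are known to be even, the halves of the
    even elements form a semigroup [Omega], and a gap count gives its genus
    [w = g./2 - r].  The odd elements of [L] below [2 * g] are then exactly [w]
    in number; together with [2 * g + 1] and translated so as to start at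
    0, they are the set [B], and adding even elements of [L] to them is what
    makes [B] closed under [Omega].  Conversely
    [max B <= 2 * w] ([closed_set_fmax]) keeps the odd elements coming from [B]
    so large that two of them always add up to at least [2 * g].  Counting the
    pairs ([Omega], [B]) gives the last part. *)

(** * Counting in intervals *)

Definition cnt (A : pred nat) (m n : nat) : nat := \sum_(m <= i < n) A i.

Lemma cnt_cat A n m p : m <= n <= p -> cnt A m p = cnt A m n + cnt A n p.
Proof. by case/andP=> mn np; rewrite /cnt (big_cat_nat mn np). Qed.

Lemma cntSr A m n : m <= n -> cnt A m n.+1 = cnt A m n + A n.
Proof. by move=> mn; rewrite /cnt big_nat_recr. Qed.

Lemma cntSl A m n : m < n -> cnt A m n = A m + cnt A m.+1 n.
Proof. by move=> mn; rewrite /cnt big_ltn. Qed.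

Lemma cnt_geq A m n : n <= m -> cnt A m n = 0.
Proof. by move=> nm; rewrite /cnt big_geq. Qed.

Lemma eq_cnt (A B : pred nat) m n :
  (forall i, m <= i < n -> A i = B i) -> cnt A m n = cnt B m n.
Proof. by move=> AB; apply: eq_big_nat => i /AB ->. Qed.

Lemma cnt_size A m n : cnt A m n = size [seq i <- index_iota m n | A i].
Proof.
rewrite size_filter -sum1_count big_mkcond /cnt.
by apply: eq_bigr => i _; case: (A i).
Qed.

Lemma cntC A m n : cnt A m n + cnt (predC A) m n = n - m.
Proof.
rewrite /cnt -big_split /= -[RHS]muln1 -sum_nat_const_nat.
by apply: eq_bigr => i _; case: (A i).
Qed.

Lemma cnt_le A m n : cnt A m n <= n - m.
Proof. by rewrite -(cntC A) leq_addr. Qed.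

Lemma leq_cnt (A B : pred nat) m n :
  (forall i, m <= i < n -> A i -> B i) -> cnt A m n <= cnt B m n.
Proof.
move=> AB; rewrite /cnt big_nat [X in _ <= X]big_nat.
by apply: leq_sum => i /AB; case: (A i) => // ->.
Qed.

Lemma cnt_pred1 a m n : m <= a < n -> cnt (pred1 a) m n = 1.
Proof.
move=> /andP[ma an].
have zero p q : ~~ (p <= a < q) -> cnt (pred1 a) p q = 0.
  move=> npq; rewrite (@eq_cnt _ pred0) /cnt ?big1_eq // => i ib /=.
  by apply/eqP => iE; rewrite -iE ib in npq.
have := @cnt_cat (pred1 a) a m n; have := @cntSl (pred1 a) a n.
rewrite (zero m a) ?(zero a.+1 n) /= ?eqxx; lia.
Qed.

(** The reflection [u |-> lo + hi - u] preserves the interval, so a set filling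
    more than half of it meets its own mirror image. *)
Lemma pigeonhole_sum (A : pred nat) lo hi :
  hi.+1 - lo < 2 * cnt A lo hi.+1 ->
  exists u v, [/\ A u, A v, lo <= u <= hi, lo <= v <= hi & u + v = lo + hi].
Proof.
move=> big; pose R := fun u => A (lo + hi - u).
have cR : cnt R lo hi.+1 = cnt A lo hi.+1.
  by rewrite /cnt [RHS]big_nat_rev; apply: eq_bigr => i _; rewrite /R addnS subSS.
case: (boolP (has (predI A R) (index_iota lo hi.+1))) => [|/hasPn noAR].
  case/hasP=> u; rewrite mem_index_iota => ub /andP[Au Ru].
  by exists u, (lo + hi - u); split=> //; lia.
have : cnt A lo hi.+1 <= cnt (predC R) lo hi.+1.
  apply: leq_cnt => i ib Ai; have := noAR i; rewrite mem_index_iota => /(_ ib).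
  by rewrite /= Ai.
by have := cntC R lo hi.+1; lia.
Qed.

(** * Sums of two elements of a sparse set *)

Definition twofold (A : pred nat) a x :=
  exists u v, [/\ A u, A v, u <= a, v <= a & x = u + v].

(** By hypothesis [A] has more than half of the integers in ]x, a] for each of
    its elements [x] strictly between [b] and [a].  For a sum close to
    [2 * a] this allows [pigeonhole_sum] on the interval from [a - x] to [a];
    once [a - x] is below the least element [z] of [A] above [b], the interval
    from [z] to [2 * a - x - z] still works, since it misses at most
    [x - (a - z)] of the elements between [z] and [a]. *)
Lemma dense_top (A : pred nat) a b :
  A a -> b < a ->
  (forall x, A x -> b < x < a -> a + 2 * cnt A 1 x.+1 < 2 * cnt A 1 a.+1 + x) ->
  forall x, x <= 2 * cnt A b.+1 a -> x <= 2 * a /\ twofold A a (2 * a - x).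
Proof.
move=> Aa ba dense x.
have exz : exists z, A z && (b < z) by exists a; rewrite Aa.
case: (ex_minnP exz) => z /andP[Az bz] zmin.
have za : z <= a by apply: zmin; rewrite Aa.
have cbz : cnt A b.+1 a = cnt A z a.
  rewrite (@cnt_cat A z) ?bz //; rewrite (@eq_cnt _ pred0 b.+1 z).
    by rewrite /cnt big1_eq.
  by move=> i ib; apply/negbTE/negP => Ai; have := zmin i; rewrite Ai; lia.
rewrite cbz => xm; have cza := cnt_le A z a.
(* Density passes from elements of [A] to all integers: moving up from an
   element to a non-element only weakens the inequality. *)
have dense' y : z <= y -> y < a -> a + 2 * cnt A 1 y.+1 < 2 * cnt A 1 a.+1 + y.
  elim: y => [|y IH] zy ya; first by lia.
  case: (boolP (A y.+1)) => [Ay|nAy]; first by apply: dense; rewrite // (leq_trans bz).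
  have zy' : z <= y by rewrite leqNgt; apply: contra nAy => ?; rewrite (_ : y.+1 = z) //; lia.
  by rewrite cntSr // (negbTE nAy) addn0; have := IH zy'; lia.
case: (leqP x (a - z)) => xk.
  have [|u [v [Au Av ub vb uv]]] := @pigeonhole_sum A (a - x) a; last first.
    by split; [lia|exists u, v; split=> //; lia].
  rewrite cntSr ?Aa; last by lia.
  have : a - (a - x) <= 2 * cnt A (a - x) a; last by lia.
  have [y yE] : exists y, y = a - x by exists (a - x).
  have zy : z <= y by lia.
  rewrite -yE; case: (ltngtP z y) zy => // [zy _|<- _].
    case: (leqP a y) => ya; first by lia.
    have := @dense' y.-1; rewrite prednK; last by lia.
    by have := @cnt_cat A y 1 a.+1; have := @cntSr A y a; rewrite Aa; lia.
  case: (ltngtP z a) za => // [za _|-> _]; last by lia.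
  have := dense' z; have := @cnt_cat A z 1 a.+1.
  by have := @cntSr A z a; have := @cntSr A 1 z; rewrite Aa Az; lia.
have [|u [v [Au Av ub vb uv]]] := @pigeonhole_sum A z (a - (x - (a - z))); last first.
  by split; [lia|exists u, v; split=> //; lia].
have := @cnt_cat A (a - (x - (a - z))).+1 z a.+1.
have := cnt_le A (a - (x - (a - z))).+1 a.+1.
have := @cntSr A z a za; rewrite Aa; lia.
Qed.

Lemma twofold_widen (A : pred nat) a b x : b <= a -> twofold A b x -> twofold A a x.
Proof.
by move=> ba [u [v [Au Av ub vb ->]]]; exists u, v; split=> //; apply: leq_trans ba.
Qed.

(** Three families of sums are disjoint: those in [s0], the translates by [b]
    of the elements of [A] in ]b, a], which are at most [a + b], and the
    interval up to [2 * a] given by [dense_top], which starts above [a + b]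
    because the density hypothesis at [b] bounds the count of [A] in ]b, a[.
    With [m] elements of [A] strictly between [b] and [a], the last two have
    [m + 1] and [2 * m + 1] elements. *)
Lemma extend_sums (A : pred nat) a b (s0 : seq nat) :
  A a -> A b -> b < a ->
  (forall x, A x -> b < x < a -> a + 2 * cnt A 1 x.+1 < 2 * cnt A 1 a.+1 + x) ->
  2 * cnt A 1 a.+1 + b <= a + 2 * cnt A 1 b.+1 ->
  uniq s0 ->
  (forall x, x \in s0 ->
     [/\ twofold A a x, x <= a + b & forall w, A w -> b < w -> x != b + w]) ->
  exists s : seq nat, [/\ uniq s, (size s).+1 = size s0 + 3 * cnt A b.+1 a.+1
              & forall x, x \in s -> twofold A a x].
Proof.
move=> Aa Ab ba dense sparse us0 s0P.
have [m mE] : exists m, m = cnt A b.+1 a by exists (cnt A b.+1 a).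
have tE : cnt A b.+1 a.+1 = m.+1 by rewrite cntSr // Aa addn1 mE.
have m_le : 2 * m + 2 + b <= a.
  by have := @cnt_cat A b.+1 1 a.+1; rewrite tE; lia.
pose sQ := [seq b + w | w <- [seq w <- index_iota b.+1 a.+1 | A w]].
pose sT := iota (2 * a - 2 * m) (2 * m).+1.
have sQP x : reflect (exists w, [/\ A w, b < w <= a & x = b + w]) (x \in sQ).
  apply: (iffP mapP) => [[w]|[w [Aw wb ->]]].
    by rewrite mem_filter mem_index_iota => /andP[Aw wb] ->; exists w; split=> //; lia.
  by exists w => //; rewrite mem_filter mem_index_iota Aw; lia.
exists (s0 ++ sQ ++ sT); split.
- rewrite cat_uniq us0 cat_uniq map_inj_uniq ?filter_uniq ?iota_uniq ?andbT ?andTb //.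
  + rewrite has_cat negb_or -andbA ?andTb; apply/and3P; split.
    * apply/hasPn => x /sQP[w [Aw /andP[bw wa] ->]]; apply/negP => /s0P[_ _ /(_ w Aw bw)].
      by rewrite eqxx.
    * by apply/hasPn => x; rewrite mem_iota => xb; apply/negP => /s0P[_ + _]; lia.
    * apply/hasPn => x; rewrite mem_iota => xb; apply/negP => /sQP[w [_ ? ?]]; lia.
  + by move=> ? ? /addnI.
- by rewrite !size_cat size_map -cnt_size size_iota tE; lia.
- move=> x; rewrite !mem_cat => /or3P[/s0P[]//|/sQP[w [Aw wb ->]]|].
    by exists b, w; split=> //; lia.
  rewrite mem_iota => xb.
  have [|_] := @dense_top A a b Aa ba dense (2 * a - x); first by lia.
  by rewrite subKn //; lia.
Qed.

(** Writing [N x] for the number of nonzero elements of [A] up to [x], the cut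
    [b] is the largest [b < a] in [A] with [a - b >= 2 * (N a - N b)].  It
    remains to feed [extend_sums] with [3 * N b + 1] sums.  If the elements up
    to [b] have no common divisor, the induction hypothesis gives [3 * N b] of
    them and one sum across the cut is missing; otherwise they are multiples of
    some [d]: they and their translates by [b] are [2 * N b + 1] sums, and adding
    the first non-multiple of [d] to those below [b] gives [N b] more, new
    because they are not multiples of [d]. *)
Lemma freiman_sparse (A : pred nat) a :
  A 0 -> A a ->
  (forall x, A x -> x <= a -> 2 * cnt A 1 x.+1 <= x) ->
  (forall d, 1 < d -> exists x, [/\ A x, x <= a & ~~ (d %| x)]) ->
  exists s : seq nat, [/\ uniq s, 3 * cnt A 1 a.+1 <= size s
              & forall x, x \in s -> twofold A a x].
Proof.
move=> A0; have [n] := ubnP a; elim: n a => // n IH a an Aa hered gcd1.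
have a_gt0 : 0 < a.
  by rewrite lt0n; apply/eqP => aE; have [x []] := gcd1 2 isT; case: x => //; lia.
(* Sparsity at [a] says that 0 is a possible cut. *)
have exb : exists b, [&& A b, b < a & 2 * cnt A 1 a.+1 + b <= a + 2 * cnt A 1 b.+1].
  exists 0; rewrite A0 a_gt0 /=; have := hered a Aa (leqnn a).
  by rewrite [cnt A 1 1]cnt_geq //; lia.
case: (@ex_maxnP _ a exb) => [b /and3P[_ /ltnW] //|b /and3P[Ab ba sparse] bmax].
have dense x : A x -> b < x < a -> a + 2 * cnt A 1 x.+1 < 2 * cnt A 1 a.+1 + x.
  by move=> Ax xb; have := bmax x; rewrite Ax; lia.
have NaE := @cnt_cat A b.+1 1 a.+1.
have exz : exists z, A z && (b < z) by exists a; rewrite Aa.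
case: (ex_minnP exz) => z /andP[Az bz] zmin.
have za : z <= a by apply: zmin; rewrite Aa.
have [gcdP|ngcdP] := pselect (forall d, 1 < d -> exists x, [/\ A x, x <= b & ~~ (d %| x)]).
  have [||s [us ss sP]] := IH b _ Ab _ gcdP; [by lia|by move=> x Ax xb; apply: hered => //; lia|].
  (* The next element [z] is not [b + 1], which would be a larger cut or, if
     equal to [a], violate the inequality at [b]. *)
  have zb : 1 < z - b.
    case: (ltnP b.+1 z) => [|zb1]; first by lia.
    have zE : z = b.+1 by lia.
    have := @cntSr A 1 b.+1 isT; move: sparse; rewrite -zE Az => sp NzE.
    case: (ltngtP z a) za => // [zlta|zaE] _; first by have := dense z Az; lia.
    by move: sp NzE; rewrite zaE; lia.
  (* The new sum is [z + y], with [y] the largest element up to [b] that is not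
     congruent to [b] modulo [z - b].  If [z + y = u + v] with [u, v <= b], then
     one of [u], [v] is not congruent to [b] either, so is at most [y], and the
     other one is less than [z]. *)
  have exy : exists y, [&& A y, y <= b & ~~ (y == b %[mod z - b])].
    have [x [Ax xb ndx]] := gcdP _ zb.
    case: (boolP (x == b %[mod z - b])) => [xE|]; last by exists x; rewrite Ax xb.
    exists 0; rewrite A0 /=; apply: contra ndx => /eqP bE.
    by rewrite /dvdn (eqP xE) -bE mod0n.
  case: (@ex_maxnP _ b exy) => [y /and3P[] //|y /and3P[Ay yb ny] ymax].
  have yltb : y < b by case: ltngtP yb ny => // ->; rewrite eqxx.
  have zE : z = b %[mod z - b] by rewrite -{1}(subnK (ltnW bz)) modnDl.
  have zy_new : forall u v, A u -> A v -> u <= b -> v <= b -> z + y <> u + v.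
    move=> u v Au Av ub vb uvE.
    have nuv w : A w -> w <= b -> w = b %[mod z - b] \/ w <= y.
      move=> Aw wb; case: (boolP (w == b %[mod z - b])) => [/eqP|nw]; first by left.
      by right; apply: ymax; rewrite Aw wb.
    have [uE|] := nuv u Au ub; last by lia.
    have [vE|] := nuv v Av vb; last by lia.
    move: ny; rewrite -(eqn_modDl z) uvE -modnDm uE vE modnDm.
    by rewrite -[X in _ == X]modnDml zE modnDml eqxx.
  have [||s' [us' ss' s'P]] := @extend_sums A a b (z + y :: s) Aa Ab ba dense sparse.
  - rewrite /= us andbT; apply/negP => /sP[u [v [Au Av ub vb]]].
    exact: zy_new.
  - move=> x; rewrite inE => /predU1P[->|/sP xP]; split.
    + by exists z, y; split=> //; lia.
    + by lia.
    + move=> w Aw bw; apply/eqP => zyE; have : z <= w by apply: zmin; rewrite Aw.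
      by lia.
    + by apply: twofold_widen xP; apply: ltnW.
    + by case: xP => u [v [_ _ ub vb ->]]; lia.
    + by case: xP => u [v [_ _ ub vb ->]] w _ bw; lia.
  by exists s'; split=> //; move: ss' => /=; lia.
have [d [d1 dP]] : exists d, 1 < d /\ forall x, A x -> x <= b -> d %| x.
  apply: contrapT => nd; apply: ngcdP => d d1; apply: contrapT => nx.
  apply: nd; exists d; split=> // x Ax xb; apply: contrapT => /negP ndx.
  by apply: nx; exists x.
have exe : exists e, [&& A e, e <= a & ~~ (d %| e)].
  by have [x [Ax xa ndx]] := gcd1 d d1; exists x; rewrite Ax xa.
case: (ex_minnP exe) => e /and3P[Ae ea nde] emin.
have be : b < e by rewrite ltnNge; apply: contra nde; apply: dP.
pose sP := [seq x <- index_iota 0 b.+1 | A x].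
pose sB := [seq b + w | w <- [seq w <- index_iota 1 b.+1 | A w]].
pose sE := [seq e + w | w <- [seq w <- index_iota 0 b | A w]].
have sPP x : x \in sP -> A x /\ x <= b.
  by rewrite mem_filter mem_index_iota => /andP[].
have sBP x : x \in sB -> exists w, [/\ A w, 0 < w <= b & x = b + w].
  by case/mapP => w; rewrite mem_filter mem_index_iota => /andP[? ?] ->; exists w; split.
have sEP x : x \in sE -> exists w, [/\ A w, w < b & x = e + w].
  by case/mapP => w; rewrite mem_filter mem_index_iota => /andP[? ?] ->; exists w; split.
have sEnd x : x \in sE -> ~~ (d %| x).
  by case/sEP => w [Aw wb ->]; rewrite dvdn_addl // dP // ltnW.
have [||s' [us' ss' s'P]] := @extend_sums A a b (sP ++ sB ++ sE) Aa Ab ba dense sparse.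
- rewrite cat_uniq filter_uniq ?iota_uniq //= cat_uniq.
  rewrite !map_inj_uniq ?filter_uniq ?iota_uniq //=; try by move=> ? ? /addnI.
  rewrite has_cat negb_or !andbT -andbA; apply/and3P; split; apply/hasPn => x.
  + by case/sBP => w [Aw wb ->]; apply/negP => /sPP[_]; lia.
  + by move/sEnd => ndx; apply/negP => /sPP[Ax xb]; rewrite dP in ndx.
  + by move/sEnd => ndx; apply/negP => /sBP[w [Aw wb xE]]; rewrite xE dvdn_add ?dP // in ndx; lia.
- move=> x; rewrite !mem_cat => /or3P[/sPP[Ax xb]|/sBP[w [Aw wb ->]]|xE]; split.
  + by exists x, 0; split=> //; lia.
  + by lia.
  + by move=> w _ bw; lia.
  + by exists b, w; split=> //; lia.
  + by lia.
  + by move=> w' _ bw; lia.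
  + by case/sEP: xE => w [Aw wb ->]; exists e, w; split=> //; lia.
  + by case/sEP: xE => w [Aw wb ->]; lia.
  + move=> w Aw bw; apply: contraNN (sEnd _ xE) => /eqP xbw.
    case/sEP: xE => w' [Aw' wb' xE]; rewrite xbw dvdn_addr; last exact: dP.
    apply: contraT => ndw; have : e <= w by apply: emin; rewrite Aw ndw; lia.
    by lia.
exists s'; split=> //; move: ss'; rewrite !size_cat !size_map -!cnt_size.
have := @cntSl A 0 b.+1; have := @cntSr A 0 b; have := @cntSl A 0 b; rewrite A0 Ab.
lia.
Qed.

(** * Gaps and genus *)

Definition inside (L : set nat) : pred nat := fun x => x \in L.
Definition gap (L : set nat) : pred nat := fun x => x \notin L.

Lemma insideP L x : reflect (L x) (inside L x).
Proof. by rewrite /inside; apply: (iffP idP); rewrite in_setE. Qed.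

Lemma gapP L x : reflect (~ L x) (gap L x).
Proof.
by rewrite /gap; apply: (iffP idP) => [/negP h Lx|h]; [apply: h|apply/negP];
  rewrite in_setE.
Qed.

Lemma cnt_gap L m n : cnt (inside L) m n + cnt (gap L) m n = n - m.
Proof. exact: cntC. Qed.

Lemma cofiniteP (L : set nat) :
  finite_set (~` L) <-> exists n, forall x, n <= x -> L x.
Proof.
split=> [fin|[n nL]].
  exists (\max_(x <- fset_set (~` L)) x).+1 => x; apply: contraPP => Lx.
  apply/negP; rewrite -leqNgt; apply: leq_bigmax_seq => //.
  by rewrite in_fset_set // in_setE.
apply: (@sub_finite_set _ _ `I_n); last exact: finite_II.
by move=> x Lx /=; rewrite ltnNge; apply/negP => /nL.
Qed.

Lemma genusE L n : (forall x, n <= x -> L x) -> genus L = cnt (gap L) 0 n.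
Proof.
move=> nL; have fin : finite_set (~` L) by apply/cofiniteP; exists n.
rewrite cnt_size /genus /gaps; apply/perm_size/uniq_perm => //.
  by rewrite filter_uniq // iota_uniq.
move=> x; rewrite in_fset_set // mem_filter mem_index_iota.
apply/idP/andP => [|[/gapP ? _]]; rewrite ?in_setE // => Lx.
by split; [apply/gapP|rewrite /= ltnNge; apply/negP => /nL].
Qed.

(** The condition [genus L < n] makes [n] large enough to separate the gaps up
    to the genus from the later ones. *)
Lemma genus_bound L : finite_set (~` L) ->
  exists n, [/\ forall x, n <= x -> L x, genus L < n & genus L = cnt (gap L) 0 n].
Proof.
move=> /cofiniteP[n nL]; exists (n + (genus L).+1).
have nL' x : n + (genus L).+1 <= x -> L x by move=> ?; apply: nL; lia.
by split=> //; [lia|apply: genusE].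
Qed.

(** * Ordinarization number *)

Lemma leastE (P : set nat) n : P n -> (forall k, P k -> n <= k) -> least P = n.
Proof.
move=> Pn nmin; apply: xget_unique; first by split.
by move=> k [Pk kmin]; apply/eqP; rewrite eqn_leq nmin // kmin.
Qed.

Lemma least_spec (P : set nat) : (exists n, P n) ->
  P (least P) /\ forall k, P k -> least P <= k.
Proof.
move=> [n Pn]; have exn : exists n, n \in P by exists n; rewrite in_setE.
case: (ex_minnP exn) => k; rewrite in_setE => Pk kmin.
have kmin' j : P j -> k <= j by move=> Pj; apply: kmin; rewrite in_setE.
by rewrite (leastE Pk kmin'); split.
Qed.

(** If there is no nonzero element up to the genus [g], then [1], ..., [g] are
    already [g] gaps, so nothing above [g] is a gap. *)
Lemma ordinaryP L : L 0 -> finite_set (~` L) ->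
  ordinary L <-> cnt (inside L) 1 (genus L).+1 = 0.
Proof.
move=> L0 fin; split=> [ordL|N0].
  rewrite (@eq_cnt _ pred0) => [|i ib]; first by rewrite /cnt big1_eq.
  by apply/insideP; rewrite ordL /=; lia.
have [n [nL gn gE]] := genus_bound fin.
have := cnt_gap L 1 (genus L).+1; rewrite N0 => Ng.
have G0 : cnt (gap L) (genus L).+1 n = 0.
  have := @cnt_cat (gap L) (genus L).+1 1 n; have := @cntSl (gap L) 0 n.
  by lia.
apply/seteqP; split=> x /=.
  move=> Lx; case: (posnP x) => [|x0]; [by left|right; rewrite ltnNge; apply/negP => xg].
  have := @cnt_cat (inside L) x 1 (genus L).+1; have := @cntSl (inside L) x (genus L).+1.
  by have/insideP -> := Lx; lia.
case=> [->//|xg]; case: (leqP n x) => [/nL//|xn].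
have := @cnt_cat (gap L) x (genus L).+1 n; have := @cntSl (gap L) x n.
by case: (gapP L x) => [|/contrapT//]; lia.
Qed.

(** The multiplicity is at most the genus since some nonzero element is; as the
    integers from 1 to the genus are then not all gaps, some gap, and hence the
    Frobenius number, lies above the genus.  The hypotheses ask only for what one step visibly
    preserves, so that the step can be iterated. *)
Lemma ordinarization_step L : L 0 -> finite_set (~` L) ->
  0 < cnt (inside L) 1 (genus L).+1 ->
  [/\ ordinarization L 0, finite_set (~` (ordinarization L)),
      genus (ordinarization L) = genus L
    & (cnt (inside (ordinarization L)) 1 (genus L).+1).+1 =
      cnt (inside L) 1 (genus L).+1].
Proof.
move=> L0 fin Npos; have [n [nL gn gE]] := genus_bound fin.
have /asboolPn/negbTE nord : ~ ordinary L by move/(ordinaryP L0 fin) => N0; lia.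
have [m0 m0b Lm0] : exists2 m, 0 < m <= genus L & L m.
  apply: contrapT => no; move: Npos; rewrite (@eq_cnt _ pred0) /cnt ?big1_eq //= => i ib.
  by apply/insideP => Li; apply: no; exists i.
have [F0 F0b LF0] : exists2 F, genus L < F & ~ L F.
  apply: contrapT => no; have : cnt (gap L) (genus L).+1 n = 0.
    rewrite (@eq_cnt _ pred0) /cnt ?big1_eq //= => i ib.
    by apply/gapP => Li; apply: no; exists i => //; lia.
  have := @cnt_cat (gap L) (genus L).+1 0 n; have := @cntSl (gap L) 0 (genus L).+1.
  by rewrite (negbTE (_ : ~~ gap L 0)) ?negbK ?in_setE //; have := cnt_gap L 1 (genus L).+1; lia.
rewrite /ordinarization nord.
have [] := @least_spec [set n | L n /\ n != 0].
  by exists m0; split=> //; lia.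
rewrite -/(multiplicity L); move: (multiplicity L) => m [Lm m0'] mmin.
have mg : m <= genus L by have /mmin : L m0 /\ m0 != 0 by [split=> //; lia]; lia.
have [F [FE LF Fg]] : exists F, [/\ F = frobenius L, ~ L F & genus L < F].
  have exF : exists F, gap L F by exists F0; apply/gapP.
  case: (@ex_maxnP (gap L) n exF) => [k /gapP Lk|F /gapP LF Fmax].
    by rewrite leqNgt; apply/negP => /ltnW/nL.
  exists F; split=> //; last by apply: leq_trans F0b (Fmax _ _); apply/gapP.
  have gapsP x : (x \in fset_set (~` L)) = gap L x.
    by rewrite in_fset_set //; apply/idP/gapP; rewrite in_setE.
  apply/eqP; rewrite eqn_leq /frobenius /gaps; apply/andP; split.
    by apply: leq_bigmax_seq => //; rewrite gapsP; apply/gapP.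
  by apply/bigmax_leqP_seq => x; rewrite gapsP => /Fmax.
rewrite -FE; set L' := (L `\ m `|` [set F]).
have L'P x : L' x <-> x = F \/ L x /\ x <> m.
  by split=> [[[Lx xm]|->]|[->|[Lx xm]]]; [right|left|right|left].
have eqL x : gap L' x + (x == F) = gap L x + (x == m).
  have -> : gap L' x = ~~ ((x == F) || inside L x && (x != m)).
    apply/gapP/idP => [L'x|nL'x /L'P[xF|[/insideP Lx /eqP xm]]].
    - apply/negP => /orP[/eqP xF|/andP[/insideP Lx /eqP xm]]; apply: L'x; apply/L'P.
        by left.
      by right.
    - by rewrite xF eqxx in nL'x.
    - by rewrite Lx xm orbT in nL'x.
  have -> : gap L x = ~~ inside L x by [].
  case: (x =P F) => [->|_] /=; last case: (x =P m) => [->|_].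
  - by case: insideP => //; case: eqP => // Fm; case: LF; rewrite Fm.
  - by move/insideP: Lm => ->.
  - by rewrite andbT.
have nL' x : n <= x -> L' x.
  by move=> nx; apply/L'P; right; split; [exact: nL|lia].
have Fn : F < n by rewrite ltnNge; apply/negP => /nL.
have sumE p q : cnt (gap L') p q + cnt (pred1 F) p q = cnt (gap L) p q + cnt (pred1 m) p q.
  by rewrite /cnt -!big_split; apply: eq_bigr => i _; exact: eqL.
split.
- by apply/L'P; right; split=> //; lia.
- by apply/cofiniteP; exists n.
- rewrite (genusE nL') gE; have := sumE 0 n; rewrite !cnt_pred1; lia.
- have := sumE 1 (genus L).+1; have := cnt_gap L 1 (genus L).+1.
  have := cnt_gap L' 1 (genus L).+1; rewrite (@cnt_pred1 m); last by lia.
  have -> : cnt (pred1 F) 1 (genus L).+1 = 0.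
    by rewrite (@eq_cnt _ pred0) /cnt ?big1_eq // => i ib /=; apply/eqP; lia.
  by have := cnt_le (inside L') 1 (genus L).+1; lia.
Qed.

Lemma ordinarization_numberE L : L 0 -> finite_set (~` L) ->
  ordinarization_number L = cnt (inside L) 1 (genus L).+1.
Proof.
move=> L0 fin; pose N := cnt (inside L) 1 (genus L).+1.
have step i : i <= N -> let L' := iter i ordinarization L in
    [/\ L' 0, finite_set (~` L'), genus L' = genus L
      & cnt (inside L') 1 (genus L).+1 + i = N].
  elim: i => [_|i IH iN] /=; first by rewrite addn0.
  have [L'0 fin' gE' NE'] := IH (ltnW iN).
  have [|L''0 fin'' gE'' NE''] := ordinarization_step L'0 fin'; first by rewrite gE'; lia.
  by rewrite gE' in gE'' NE''; split=> //; lia.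
rewrite -/N; apply: leastE => [|k] /=.
  by have [L'0 fin' gE' NE'] := step N (leqnn N); apply/ordinaryP => //; rewrite gE'; lia.
move=> ordk; rewrite leqNgt; apply/negP => kN.
have [L'0 fin' gE' NE'] := step k (ltnW kN).
by have := (ordinaryP L'0 fin').1 ordk; rewrite gE'; lia.
Qed.

(** * Gaps of a numerical semigroup *)

Lemma gap_pairs L x lo hi : numerical_semigroup L -> ~ L x -> lo + hi = x ->
  2 * cnt (inside L) lo hi.+1 <= hi.+1 - lo.
Proof.
move=> [_ LD _] Lx xE; rewrite leqNgt; apply/negP.
case/pigeonhole_sum => u [v [/insideP Lu /insideP Lv _ _ uv]].
by apply: Lx; rewrite -xE -uv; apply: LD.
Qed.

(** At most half of the integers strictly between 0 and a gap [x] are elements,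
    since complementary pairs add up to [x]; the others, and [x] itself, are
    gaps. *)
Lemma gap_lt L x : numerical_semigroup L -> ~ L x -> x < 2 * genus L.
Proof.
move=> sgL Lx; have [L0 LD fin] := sgL; have [n [nL gn gE]] := genus_bound fin.
have x0 : 0 < x by rewrite lt0n; apply/eqP => x0; apply: Lx; rewrite x0.
have xn : x < n by rewrite ltnNge; apply/negP => /nL.
have := @gap_pairs L x 1 x.-1 sgL Lx; rewrite prednK // add1n prednK // => /(_ erefl).
have := cnt_gap L 1 x; have := @cnt_cat (gap L) 1 0 n; have := @cnt_cat (gap L) x 1 n.
by have := @cntSl (gap L) x n; case: gapP => // _; lia.
Qed.

Lemma genus_cnt L n : numerical_semigroup L -> 2 * genus L <= n ->
  genus L = cnt (gap L) 0 n.
Proof.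
move=> sgL gn; apply: genusE => x nx; apply: contrapT => /(gap_lt sgL); lia.
Qed.

Lemma cnt_inside0 L n : L 0 -> cnt (inside L) 0 n.+1 = (cnt (inside L) 1 n.+1).+1.
Proof. by move=> /insideP L0; rewrite cntSl // L0. Qed.

(** Otherwise every integer from [x] on is an element: for [x < y < 2 * x] with
    [y] a gap, [y - x] is a gap too, and pairing the integers below [y - x]
    as well as those from [y - x] to [x] bounds the count up to [x].
    But then all gaps are below [x], and there are fewer than [x] of them. *)
Lemma semigroup_sparse L x : numerical_semigroup L -> L x -> x <= genus L ->
  2 * cnt (inside L) 1 x.+1 <= x.
Proof.
move=> sgL Lx xg; have [L0 LD fin] := sgL; rewrite leqNgt; apply/negP => dense.
have x0 : 0 < x by case: x {Lx xg} dense; rewrite // cnt_geq.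
have all_in y : x <= y -> L y.
  have [k] := ubnP y; elim: k y => // k IH y yk xy.
  case: (leqP (2 * x) y) => y2x.
    by rewrite -(subnK xy); apply: LD => //; apply: IH; lia.
  apply: contrapT => Ly; have Lc : ~ L (y - x).
    by move=> Lc; apply: Ly; rewrite -(subnK xy); apply: LD.
  have c0 : 0 < y - x by rewrite lt0n; apply/eqP => c0; apply: Lc; rewrite c0.
  have := @gap_pairs L (y - x) 1 (y - x).-1 sgL Lc; rewrite add1n prednK // => /(_ erefl).
  have := @gap_pairs L y (y - x) x sgL Ly (subnK xy).
  by have := @cnt_cat (inside L) (y - x) 1 x.+1; lia.
have gE := genusE all_in; have := cnt_gap L 0 x.
by have := @cntSl (inside L) 0 x; have/insideP -> := L0; lia.
Qed.

Lemma dvd_count (L : set nat) d n : 0 < d ->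
  (forall x, L x -> x <= n -> d %| x) -> d * cnt (inside L) 1 n.+1 <= n.
Proof.
move=> d0 dL; apply: leq_trans (_ : d * (n %/ d) <= n); last by lia.
rewrite leq_mul2l; apply/orP; right.
apply: (@leq_trans (cnt (fun x => d %| x) 1 n.+1)).
  by apply: leq_cnt => i ib /insideP Li; apply: dL => //; lia.
elim: n {dL} => [|n IH]; first by rewrite cnt_geq.
by rewrite cntSr // divnS // addnC leq_add2l.
Qed.

(** The sums provided by [freiman_sparse] would be at least [genus L + 2]
    elements up to [2 * genus L], more than there are. *)
Lemma semigroup_even L x : numerical_semigroup L ->
  genus L + 2 <= 3 * cnt (inside L) 1 (genus L).+1 ->
  L x -> x <= genus L -> ~~ odd x.
Proof.
move=> sgL big Lx xg; have [L0 LD fin] := sgL; set g := genus L in big xg *.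
have exa : exists a, inside L a && (a <= g) by exists 0; rewrite andbT; apply/insideP.
case: (@ex_maxnP _ g exa) => [a /andP[]//|a /andP[/insideP La ag] amax].
have NaE : cnt (inside L) 1 g.+1 = cnt (inside L) 1 a.+1.
  rewrite (@cnt_cat _ a.+1 1); last by lia.
  rewrite [X in _ + X](@eq_cnt _ pred0) /cnt ?big1_eq ?addn0 // => i ib.
  by apply/negP => Li; have := amax i; rewrite Li; lia.
have [gcd1|] := pselect (forall d, 1 < d -> exists x, [/\ inside L x, x <= a & ~~ (d %| x)]).
  have [||||s [us ss sP]] := @freiman_sparse (inside L) a; rewrite //.
  - exact/insideP.
  - exact/insideP.
  - by move=> y /insideP Ly ya; apply: semigroup_sparse => //; lia.
  have : size s <= size [seq y <- index_iota 0 (2 * g).+1 | inside L y].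
    apply: uniq_leq_size => // y /sP[u [v [/insideP Lu /insideP Lv ua va ->]]].
    by rewrite mem_filter mem_index_iota; apply/andP; split; [apply/insideP; apply: LD|lia].
  rewrite -cnt_size; have := cnt_gap L 0 (2 * g).+1.
  by have := @genus_cnt L (2 * g).+1 sgL; rewrite -/g; lia.
move=> ngcd; have [d [d1 dP]] : exists d, 1 < d /\ forall x, L x -> x <= g -> d %| x.
  apply: contrapT => nd; apply: ngcd => d d1; apply: contrapT => nx.
  apply: nd; exists d; split=> // y Ly yg; apply: contrapT => /negP ndy.
  by apply: nx; exists y; split=> //; [apply/insideP|apply: amax; rewrite yg andbT; apply/insideP].
have := @dvd_count L d g (ltnW d1) dP => dN.
(* With [r] the count, [3 * r >= g + 2] excludes [d * r <= g] for [d >= 3]. *)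
have d2 : d = 2 by case: d d1 {dP} dN => [|[|[|d]]] // _; nia.
by have := dP x Lx xg; rewrite d2 dvdn2.
Qed.

Lemma cnt_shift (A : pred nat) c n :
  cnt (fun i => A (i - c)) c (c + n) = cnt A 0 n.
Proof.
rewrite /cnt -{1}[c]add0n big_addn addKn.
by apply: eq_bigr => i _; rewrite addnK.
Qed.

(** * Semigroups built from a closed set *)

Lemma cnt_gap_comp L (f : nat -> nat) m n :
  cnt (fun i => inside L (f i)) m n + cnt (fun i => gap L (f i)) m n = n - m.
Proof. exact: cntC. Qed.

Lemma cnt_parity (A : pred nat) n :
  cnt A 0 n = cnt (fun j => A (2 * j)) 0 (uphalf n) + cnt (fun i => A (2 * i + 1)) 0 n./2.
Proof.
elim: n => [|n IH]; first by rewrite !cnt_geq.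
rewrite cntSr // {}IH; case: (boolP (odd n)) => on.
  have -> : uphalf n.+1 = uphalf n by lia.
  have -> : n.+1./2 = (n./2).+1 by lia.
  have nE : 2 * n./2 + 1 = n by lia.
  by rewrite (cntSr _ (leq0n n./2)) nE addnA.
have -> : uphalf n.+1 = (uphalf n).+1 by lia.
have -> : n.+1./2 = n./2 by lia.
have nE : 2 * uphalf n = n by lia.
by rewrite (cntSr _ (leq0n (uphalf n))) nE addnAC.
Qed.

Lemma card_cnt (B : {fset nat}) n : (forall x, x \in B -> x < n) ->
  #|` B| = cnt (fun x => x \in B) 0 n.
Proof.
move=> Bn; rewrite cnt_size; apply/perm_size/uniq_perm => //.
  by rewrite filter_uniq // iota_uniq.
move=> x; rewrite mem_filter mem_index_iota /=.
by apply/idP/andP => [xB|[]//]; split=> //; apply: Bn.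
Qed.

Lemma leq_fmax (B : {fset nat}) b : b \in B -> b <= fmax B.
Proof. by move=> bB; apply: leq_bigmax_seq. Qed.

Lemma fmax_in (B : {fset nat}) : 0 \in B -> fmax B \in B.
Proof.
move=> B0; rewrite /fmax big_seq; apply: (big_ind (fun x => x \in B)) => //.
by move=> x y xB yB; case: (leqP x y).
Qed.

Definition closed_pair (w : nat) (Omega : set nat) (B : {fset nat}) : Prop :=
  [/\ numerical_semigroup Omega, genus Omega = w &
     [/\ closed_set Omega B, #|` B| = w.+1 & 0 \in B]].

(** Since [0] is in [B], all elements of [Omega] up to [max B] are in [B], so
    there are at most [w + 1] of them, besides at most [w] gaps. *)
Lemma closed_set_fmax w Omega B : closed_pair w Omega B -> fmax B <= 2 * w.
Proof.
case=> sg gE [[_ cl] cB B0]; have [_ _ fin] := sg.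
have [n [nL _ gcnt]] := genus_bound fin.
have : cnt (inside Omega) 0 (fmax B).+1 <= #|` B|.
  rewrite cnt_size; apply: uniq_leq_size; first by rewrite filter_uniq // iota_uniq.
  move=> x; rewrite mem_filter mem_index_iota => /andP[/insideP Ox xM].
  by have [//|] := cl 0 x B0 Ox; rewrite add0n; lia.
have gap_le : cnt (gap Omega) 0 (fmax B).+1 <= w.
  rewrite -gE gcnt; case: (leqP (fmax B).+1 n) => Mn.
    by rewrite [leqRHS](@cnt_cat _ (fmax B).+1) //; lia.
  rewrite (@cnt_cat _ n) ?(ltnW Mn) // [X in _ + X](@eq_cnt _ pred0).
    by rewrite /cnt big1_eq addn0.
  by move=> i ib; apply/gapP => Oi; apply: Oi; apply: nL; lia.
by have := cnt_gap Omega 0 (fmax B).+1; lia.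
Qed.

Lemma semigroup_from_odd g Omega B i :
  semigroup_from g Omega B (2 * i + 1) <->
  g <= i \/ exists2 j, j \in B & i + fmax B = j + g.
Proof.
split=> [[[[j _ jE]|[j jB jE]]|/=]|[gi|[j jB jE]]].
- by lia.
- by right; exists j => //; lia.
- by left; lia.
- by right => /=; lia.
- by left; right; exists j => //; lia.
Qed.

Lemma semigroup_from_even g Omega B j :
  numerical_semigroup Omega -> 2 * genus Omega <= g ->
  semigroup_from g Omega B (2 * j) <-> Omega j.
Proof.
move=> sg wg; split=> [[[[i Oi iE]|[i _ iE]]|/= gj]|Oj].
- by have <- : i = j by lia.
- by lia.
- by apply: contrapT => /(gap_lt sg); lia.
- by left; left; exists j.
Qed.

Lemma semigroup_from_ge g Omega B n : 2 * g <= n -> semigroup_from g Omega B n.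
Proof. by move=> gn; right. Qed.

Lemma even_odd_ind (P : nat -> Prop) :
  (forall j, P (2 * j)) -> (forall i, P (2 * i + 1)) -> forall n, P n.
Proof.
move=> Pe Po n; case: (boolP (odd n)) => on.
  by rewrite (_ : n = 2 * n./2 + 1); [apply: Po|lia].
by rewrite (_ : n = 2 * n./2); [apply: Pe|lia].
Qed.

(** Even plus odd is the closure of [B] under [Omega].  Two odd elements are each
    at least [2 * (g - max B) + 1 >= 2 * g - 4 * w + 1], so their sum is at least
    [2 * g]. *)
Lemma semigroup_from_add g w Omega B : closed_pair w Omega B -> 6 * w <= g ->
  forall a b, semigroup_from g Omega B a -> semigroup_from g Omega B b ->
    semigroup_from g Omega B (a + b).
Proof.
move=> cp wg; have M2w := closed_set_fmax cp.
have [sg gE [[_ cl] _ _]] := cp; have [_ OD _] := sg.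
have wg' : 2 * genus Omega <= g by lia.
have evodd j i : Omega j -> semigroup_from g Omega B (2 * i + 1) ->
    semigroup_from g Omega B (2 * j + (2 * i + 1)).
  rewrite (_ : 2 * j + (2 * i + 1) = 2 * (i + j) + 1); last by lia.
  move=> Oj /semigroup_from_odd iL; apply/semigroup_from_odd.
  case: iL => [gi|[k kB kE]]; first by left; lia.
  have [kjB|] := cl k j kB Oj; first by right; exists (k + j) => //; lia.
  by left; lia.
elim/even_odd_ind => a; elim/even_odd_ind => b.
- rewrite -mulnDr; do 2 move/(semigroup_from_even _ _ sg wg') => ?.
  by apply/semigroup_from_even => //; apply: OD.
- by move/(semigroup_from_even _ _ sg wg'); apply: evodd.
- by move=> La /(semigroup_from_even _ _ sg wg') Ob; rewrite addnC; apply: evodd.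
- move=> /semigroup_from_odd La /semigroup_from_odd Lb; apply: semigroup_from_ge.
  have small i : g <= i \/ (exists2 j, j \in B & i + fmax B = j + g) -> g <= 2 * i.
    by case=> [|[j _]]; lia.
  by have := small _ La; have := small _ Lb; lia.
Qed.

(** Below [2 * g] there are [w] even gaps, twice those of [Omega], and all but
    [w] of the odd numbers; the exceptions come from the elements of [B] other
    than its maximum, which gives [2 * g + 1].  All odd elements are above [g],
    so the nonzero elements up to [g] come from [Omega], which has its [w] gaps
    in [1, g / 2]. *)
Lemma semigroup_from_correct g r Omega B :
  g + 2 <= 3 * r -> r <= g./2 -> closed_pair (g./2 - r) Omega B ->
  [/\ numerical_semigroup (semigroup_from g Omega B),
      genus (semigroup_from g Omega B) = g
    & ordinarization_number (semigroup_from g Omega B) = r].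
Proof.
move=> hr1 hr2 cp; set w := g./2 - r in cp; set L := semigroup_from g Omega B.
have wg : 6 * w <= g by lia.
have M2w := closed_set_fmax cp; have [sg gE [[_ cl] cB B0]] := cp.
have [O0 OD _] := sg; have wg' : 2 * genus Omega <= g by lia.
have L0 : L 0 by rewrite -[0]/(2 * 0); apply/semigroup_from_even.
have fin : finite_set (~` L).
  by apply/cofiniteP; exists (2 * g) => x; apply: semigroup_from_ge.
have sgL : numerical_semigroup L by split=> //; apply: (semigroup_from_add cp).
have evenE j : inside L (2 * j) = inside Omega j.
  by apply/insideP/insideP => ?; apply/(semigroup_from_even B j sg wg').
have geL : genus L = g.
  rewrite (@genusE _ (2 * g)) => [|x]; last exact: semigroup_from_ge.
  rewrite cnt_parity; have -> : uphalf (2 * g) = g by lia.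
  have -> : (2 * g)./2 = g by lia.
  have -> : cnt (fun j => gap L (2 * j)) 0 g = cnt (gap Omega) 0 g.
    by apply: eq_cnt => j _; rewrite /gap -/(inside L (2 * j)) evenE.
  rewrite -genus_cnt // gE.
  have : cnt (fun i => inside L (2 * i + 1)) 0 g = w.
    rewrite (@cnt_cat _ (g - fmax B)); last by lia.
    rewrite (@eq_cnt _ pred0 0) => [|i ib]; last first.
      by apply/insideP => /semigroup_from_odd[|[j _]]; lia.
    have := @card_cnt B (fmax B).+1 (fun x xB => leq_fmax xB).
    rewrite cB cntSr // fmax_in // addn1 => -[->].
    rewrite [X in X + _]/cnt big1_eq add0n -(cnt_shift _ (g - fmax B)).
    rewrite subnK; last by lia.
    apply: eq_cnt => i ib; apply/insideP/idP => [/semigroup_from_odd[|[j jB jE]]|iB].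
    - by lia.
    - by rewrite (_ : i - _ = j) //; lia.
    - by apply/semigroup_from_odd; right; exists (i - (g - fmax B)) => //; lia.
  by have := cnt_gap_comp L (fun i => 2 * i + 1) 0 g; lia.
split=> //; rewrite ordinarization_numberE // geL.
apply: succn_inj; rewrite -cnt_inside0 // cnt_parity.
rewrite [X in _ + X](@eq_cnt _ pred0) => [|i ib]; last first.
  by apply/insideP => /semigroup_from_odd[|[j _]]; lia.
rewrite [X in _ + X]/cnt big1_eq addn0 (@eq_cnt _ (inside Omega)) // .
have -> : uphalf g.+1 = (g./2).+1 by lia.
have := cnt_gap Omega 0 (g./2).+1; have := @genus_cnt Omega (g./2).+1 sg.
by lia.
Qed.

(** The even elements determine [Omega].  The least odd element is
    [2 * (g - max B) + 1], so it determines [max B], and then the odd elements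
    up to [2 * g + 1] determine [B]. *)
Lemma semigroup_from_inj g w Omega B Omega' B' :
  2 * w <= g -> closed_pair w Omega B -> closed_pair w Omega' B' ->
  semigroup_from g Omega B = semigroup_from g Omega' B' ->
  Omega = Omega' /\ B = B'.
Proof.
move=> wg cp cp' LE; have M2w := closed_set_fmax cp; have M2w' := closed_set_fmax cp'.
have [sg gE [_ _ B0]] := cp; have [sg' gE' [_ _ B0']] := cp'.
split.
  apply/seteqP; split=> j.
    move/(@semigroup_from_even g _ B) => /(_ sg); rewrite LE gE => /(_ wg).
    by move/semigroup_from_even; apply=> //; rewrite gE'.
  move/(@semigroup_from_even g _ B') => /(_ sg'); rewrite -LE gE' => /(_ wg).
  by move/semigroup_from_even; apply=> //; rewrite gE.
have fmax_le C C' O O' : fmax C <= g -> 0 \in C ->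
    semigroup_from g O C = semigroup_from g O' C' -> fmax C <= fmax C'.
  move=> Cg C0 CE; have : semigroup_from g O C (2 * (g - fmax C) + 1).
    by apply/semigroup_from_odd; right; exists 0 => //; lia.
  by rewrite CE => /semigroup_from_odd[|[j _]]; lia.
have ME : fmax B = fmax B'.
  by apply/eqP; rewrite eqn_leq !(fmax_le _ _ _ _ _ _ LE, fmax_le _ _ _ _ _ _ (esym LE)) //; lia.
have sub C C' O O' : fmax C = fmax C' -> fmax C <= g -> 0 \in C' ->
    semigroup_from g O C = semigroup_from g O' C' -> {subset C <= C'}.
  move=> CC Cg C0 CE j jC; have jM := leq_fmax jC.
  case: (ltngtP j (fmax C)) jM => // [jM _|-> _]; last by rewrite CC fmax_in.
  have : semigroup_from g O C (2 * (g - fmax C + j) + 1).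
    by apply/semigroup_from_odd; right; exists j => //; lia.
  rewrite CE => /semigroup_from_odd[|[k kC kE]]; first by lia.
  by have -> : j = k by lia.
apply/fsetP => j; apply/idP/idP; first by apply: (sub _ _ _ _ ME _ _ LE) => //; lia.
by apply: (sub _ _ _ _ (esym ME) _ _ (esym LE)) => //; lia.
Qed.

(** * Every semigroup comes from a closed set *)

(** The even elements up to [g] leave [w = g./2 - r] gaps of [Omega] in
    [1, g / 2].  A least gap [x] of [Omega] above [g / 2] would have only
    these [w] gaps below it, although at least [(x - 1) / 2] of the integers
    below a gap are gaps; this contradicts [3 * w < g / 2]. *)
Lemma even_half_genus g r L :
  g + 2 <= 3 * r -> r <= g./2 -> numerical_semigroup L -> genus L = g ->
  cnt (inside L) 1 g.+1 = r ->
  numerical_semigroup [set j | L (2 * j)] /\ genus [set j | L (2 * j)] = g./2 - r.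
Proof.
move=> hr1 hr2 sgL gE NE; have [L0 LD fin] := sgL; set Omega := [set j | L (2 * j)].
have [n nL] := (cofiniteP L).1 fin.
have sg : numerical_semigroup Omega.
  split=> [//|a b Oa Ob|]; first by rewrite /Omega /= mulnDr; apply: LD.
  by apply/cofiniteP; exists n => x nx; apply: nL; lia.
split=> //; have Ocnt : cnt (inside Omega) 0 (g./2).+1 = r.+1.
  rewrite -NE -cnt_inside0 // [RHS]cnt_parity.
  rewrite [X in _ = _ + X](@eq_cnt _ pred0) => [|i ib]; last first.
    apply/insideP => Li; have := @semigroup_even L _ sgL _ Li.
    by rewrite gE NE => /(_ hr1); lia.
  rewrite [X in _ = _ + X]/cnt big1_eq addn0 (_ : uphalf g.+1 = (g./2).+1); last by lia.
  by apply: eq_cnt => j _; apply/insideP/insideP.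
have := cnt_gap Omega 0 (g./2).+1; rewrite Ocnt => Ogap.
rewrite (@genusE _ (g./2).+1) => [|x]; first by lia.
have [k] := ubnP x; elim: k x => // k IH x xk hx; apply: contrapT => Ox.
have := @gap_pairs Omega x 1 x.-1 sg Ox; rewrite add1n prednK; last by lia.
move=> /(_ erefl); have := cnt_gap Omega 1 x.
have := @cnt_cat (gap Omega) (g./2).+1 1 x.
have -> : cnt (gap Omega) (g./2).+1 x = 0.
  rewrite (@eq_cnt _ pred0) /cnt ?big1_eq // => i ib.
  by apply/gapP => Oi; apply: Oi; apply: IH; lia.
by have := @cntSl (gap Omega) 0 (g./2).+1; lia.
Qed.

(** [B] collects the odd elements [2 * i + 1] with [i <= g], shifted by the least
    such index [i0]; its maximum is [g - i0] because [2 * g + 1] is an element.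
    Its size follows from the genus: of the gaps below [2 * g], [w] are even, so
    [g - w] are odd. *)
Lemma semigroup_from_onto g r L :
  g + 2 <= 3 * r -> r <= g./2 ->
  numerical_semigroup L -> genus L = g -> ordinarization_number L = r ->
  exists Omega B, closed_pair (g./2 - r) Omega B /\ L = semigroup_from g Omega B.
Proof.
move=> hr1 hr2 sgL gE ordE; have [L0 LD fin] := sgL.
have NE : cnt (inside L) 1 g.+1 = r by rewrite -ordE ordinarization_numberE // gE.
have [sg wE] := even_half_genus hr1 hr2 sgL gE NE.
set Omega := [set j | L (2 * j)] in sg wE.
have Lge x : 2 * g <= x -> L x by move=> gx; apply: contrapT => /(gap_lt sgL); rewrite gE; lia.
pose odd_in i := inside L (2 * i + 1).
have exi : exists i, odd_in i by exists g; apply/insideP; apply: Lge; lia.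
case: (ex_minnP exi) => i0 Li0 i0min.
have i0g : i0 <= g by apply: i0min; apply/insideP; apply: Lge; lia.
pose Bs := [seq j <- iota 0 (g - i0).+1 | odd_in (i0 + j)].
pose B : {fset nat} := [fset j in Bs]%fset.
have inB j : (j \in B) = odd_in (i0 + j) && (j <= g - i0).
  by rewrite !inE mem_filter mem_iota /= add0n ltnS.
have ME : fmax B = g - i0.
  apply/eqP; rewrite eqn_leq; apply/andP; split.
    by apply/bigmax_leqP_seq => j; rewrite inB => /andP[].
  by apply: leq_fmax; rewrite inB leqnn andbT; apply/insideP; apply: Lge; lia.
have B0 : 0 \in B by rewrite inB addn0 Li0.
have gcnt := @genus_cnt L (2 * g) sgL; rewrite gE cnt_parity in gcnt.
have cB : #|` B| = (g./2 - r).+1.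
  rewrite (@card_cnt B (g - i0).+1) => [|j]; last by rewrite inB => /andP[].
  rewrite -(cnt_shift _ i0) (@eq_cnt _ odd_in) => [|i ib]; last first.
    by rewrite inB subnKC; [rewrite andbC (_ : i - i0 <= g - i0) //|]; lia.
  rewrite addnS subnKC // cntSr //.
  have -> : odd_in g by apply/insideP; apply: Lge; lia.
  rewrite addn1; congr _.+1.
  have := @cnt_cat odd_in i0 0 g; rewrite (@eq_cnt odd_in pred0 0 i0) => [|i ib]; last first.
    by apply: negbTE; apply/negP => /i0min; lia.
  rewrite [X in X + _]/cnt big1_eq add0n => /(_ _) <-; last by lia.
  have := cnt_gap_comp L (fun i => 2 * i + 1) 0 g; rewrite -/odd_in.
  have : cnt (fun j => gap L (2 * j)) 0 g = g./2 - r.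
    by rewrite -wE (@genus_cnt Omega g) // wE; lia.
  move: (gcnt (leqnn _)); rewrite (_ : uphalf (2 * g) = g); last by lia.
  rewrite (_ : (2 * g)./2 = g); last by lia.
  by lia.
exists Omega, B; split.
  split=> //; split=> //; split; first by apply/fset0Pn; exists 0.
  move=> b l; rewrite inB => /andP[/insideP Lb bM] Ol.
  case: (leqP (b + l) (fmax B)) => blM; [left|by right].
  rewrite inB -ME blM andbT; apply/insideP.
  rewrite (_ : _ + 1 = 2 * (i0 + b) + 1 + 2 * l); last by lia.
  exact: LD.
have wg : 2 * genus Omega <= g by rewrite wE; lia.
apply/seteqP; split; elim/even_odd_ind => i.
- by move=> Li; apply/semigroup_from_even.
- move=> Li; apply/semigroup_from_odd; case: (leqP g i) => gi; [by left|right].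
  have i0i : i0 <= i by apply: i0min; apply/insideP.
  exists (i - i0); last by lia.
  by rewrite inB subnKC //; apply/andP; split; [apply/insideP|lia].
- by move/(semigroup_from_even _ _ sg wg).
- move/semigroup_from_odd => [gi|[j]]; first by apply: Lge; lia.
  by rewrite inB ME => /andP[/insideP Lj jM] jE; rewrite (_ : i = i0 + j) //; lia.
Qed.

(** * Counting *)

Lemma finite_subsets n (C : set {fset nat}) :
  (forall B, C B -> forall b, b \in B -> b < n) -> finite_set C.
Proof.
move=> Cn; pose F : {fset nat} := [fset i in iota 0 n]%fset.
apply: (@sub_finite_set _ _ [set` fpowerset F]); last exact: finite_fset.
move=> B CB /=; rewrite fpowersetE; apply/fsubsetP => b /(Cn B CB) bn.
by rewrite !inE mem_iota.
Qed.

Lemma finite_semigroups_of_genus g : finite_set (semigroups_of_genus g).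
Proof.
pose gapsets := [set X : {fset nat} | forall x, x \in X -> x < 2 * g].
apply: (@sub_finite_set _ _ [set ~` [set` X] | X in gapsets]).
  move=> L [sgL gE]; have [_ _ fin] := sgL; exists (gaps L).
    by move=> x; rewrite in_fset_set // in_setE => /(gap_lt sgL); rewrite gE.
  by rewrite /gaps fset_setK // setCK.
by apply: finite_image; apply: (@finite_subsets (2 * g)).
Qed.

Lemma finite_closed_sets w Omega : semigroups_of_genus w Omega ->
  finite_set (closed_sets Omega w.+1).
Proof.
move=> [sg gE]; apply: (@finite_subsets (2 * w).+1) => B [cl cB B0] b bB.
have /closed_set_fmax : closed_pair w Omega B by [].
by rewrite ltnS; apply: leq_trans; apply: leq_fmax.
Qed.

(** By [semigroup_from_inj] and [semigroup_from_onto], [semigroup_from g] lists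
    the semigroups without repetition when applied to all pairs. *)
Lemma card_semigroups g r : g + 2 <= 3 * r -> r <= g./2 ->
  card (semigroups_of_genus_ordnumber g r) =
  \sum_(Omega <- fset_set (semigroups_of_genus (g./2 - r)))
     card (closed_sets Omega (g./2 - r).+1).
Proof.
move=> hr1 hr2; set w := g./2 - r.
have finS : finite_set (semigroups_of_genus_ordnumber g r).
  apply: sub_finite_set (finite_semigroups_of_genus g).
  by move=> L [].
pose pairs := [seq semigroup_from g Omega B
  | Omega <- fset_set (semigroups_of_genus w), B <- fset_set (closed_sets Omega w.+1)].
have pairP Omega B : Omega \in fset_set (semigroups_of_genus w) ->
    B \in fset_set (closed_sets Omega w.+1) -> closed_pair w Omega B.
  rewrite in_fset_set; last exact: finite_semigroups_of_genus.
  rewrite in_setE => OS; rewrite in_fset_set; last exact: finite_closed_sets.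
  by rewrite in_setE; case: OS => ? ? [? ? ?].
transitivity (size pairs); last first.
  by rewrite size_allpairs_dep sumnE big_map.
apply/perm_size/uniq_perm => //.
  apply: allpairs_uniq_dep => [|Omega _|p q]; [exact: fset_uniq..|].
  move=> /allpairsPdep[O [B [OS BC ->]]].
  move=> /allpairsPdep[O' [B' [OS' BC' ->]]] /=.
  case/(@semigroup_from_inj g w _ _ _ _ _ (pairP _ _ OS BC) (pairP _ _ OS' BC')).
    by lia.
  by move=> -> ->.
move=> L; rewrite in_fset_set //; apply/idP/allpairsPdep.
  rewrite in_setE => -[sgL gE oE].
  have [Omega [B [cp ->]]] := semigroup_from_onto hr1 hr2 sgL gE oE.
  have [sg wE BP] := cp; have OS : semigroups_of_genus w Omega by [].
  exists Omega, B; split=> //; rewrite in_fset_set ?in_setE //.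
    exact: finite_semigroups_of_genus.
  exact: finite_closed_sets.
move=> [Omega [B [OS BC ->]]]; rewrite in_setE.
exact: semigroup_from_correct (pairP _ _ OS BC).
Qed.

Lemma leq_of_rat_bound g r : ((g%:R + 2) / 3 <= r%:R :> rat)%R -> g + 2 <= 3 * r.
Proof.
by rewrite Num.Theory.ler_pdivrMr // -GRing.natrD -GRing.natrM Num.Theory.ler_nat mulnC.
Qed.

Theorem theorem13 (g r : nat)
    (hr1 : ((g%:R + 2) / 3 <= r%:R :> rat)%R) (hr2 : r <= g./2) :
  let w := g./2 - r in
  [/\ (* 1 *)
      forall (Omega : set nat) (B : {fset nat}),
        numerical_semigroup Omega -> genus Omega = w ->
        closed_set Omega B -> #|` B| = w.+1 -> 0 \in B ->
        [/\ numerical_semigroup (semigroup_from g Omega B),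
            genus (semigroup_from g Omega B) = g
          & ordinarization_number (semigroup_from g Omega B) = r],
      (* 2 *)
      forall L : set nat,
        numerical_semigroup L -> genus L = g -> ordinarization_number L = r ->
        exists! OB : set nat * {fset nat},
          [/\ numerical_semigroup OB.1, genus OB.1 = w,
              [/\ closed_set OB.1 OB.2, #|` OB.2| = w.+1 & 0 \in OB.2]
            & L = semigroup_from g OB.1 OB.2]
    & (* 3 *)
      [/\ (* the sets being counted are finite *)
          [/\ finite_set (semigroups_of_genus_ordnumber g r),
              finite_set (semigroups_of_genus w)
            & forall Omega, semigroups_of_genus w Omega ->
                finite_set (closed_sets Omega w.+1)],
          forall g' r' : nat,
            ((g'%:R + 2) / 3 <= r'%:R :> rat)%R -> r' <= g'./2 ->
            g'./2 - r' = w ->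
            card (semigroups_of_genus_ordnumber g' r') =
            card (semigroups_of_genus_ordnumber g r)
        & card (semigroups_of_genus_ordnumber g r) =
          \sum_(Omega <- fset_set (semigroups_of_genus w))
             card (closed_sets Omega w.+1)]].
Proof.
move=> w; have hr := leq_of_rat_bound hr1; split.
- move=> Omega B sg gE cl cB B0.
  by apply: semigroup_from_correct => //.
- move=> L sgL gE oE.
  have [Omega [B [cp LE]]] := semigroup_from_onto hr hr2 sgL gE oE.
  exists (Omega, B); split=> [|[Omega' B'] /= [sg' wE' BP' LE']].
    by case: cp => sg wE BP; split.
  have cp' : closed_pair w Omega' B' by [].
  have [|-> -> //] := semigroup_from_inj _ cp cp' (etrans (esym LE) LE').
  by rewrite /w; lia.
- split; last exact: card_semigroups.
    split; last exact: finite_closed_sets.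
      by apply: sub_finite_set (finite_semigroups_of_genus g) => L [].
    exact: finite_semigroups_of_genus.
  move=> g' r' /leq_of_rat_bound hr' hr2' wE.
  by rewrite !card_semigroups // wE.
Qed.
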